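(* There is an absolute constant $c>0$ such that for every $f\in C[0,1]$ and every integer $n\ge 1$: (1) for every $0<q<1$, $$\|R_{n,q}(f)-R_{\infty,q}(f)\|\le c\,\omega_2\!\left(f,\sqrt{q^{n}}\right);$$ (2) moreover, $$\sup_{0<q\le 1}\|R_{n,q}(f)-R_{\infty,q}(f)\|\le c\,\omega_2\!\left(f,n^{-1/2}\right).$$
   Context: For $q>0$ and an integer $n\ge 0$: $[n]=1+q+\dots+q^{n-1}$, $[0]=0$; $[n]!=[1][2]\cdots[n]$, $[0]!=1$; for $0\le k\le n$ let ${n\brack k}=\frac{[n]!}{[k]!\,[n-k]!}$. The Lupaş $q$-analogue of the Bernstein operator is, for $f\in C[0,1]$, $x\in[0,1]$, $n\ge1$, $$R_{n,q}(f,x)=\sum_{k=0}^{n} f\!\left(\tfrac{[k]}{[n]}\right) {n\brack k}\frac{q^{k(k-1)/2}x^{k}(1-x)^{n-k}}{(1-x+qx)\cdots(1-x+q^{n-1}x)}$$ (for $q=1$ this is the classical Bernstein polynomial). For $0<q<1$ the limit $q$-Lupaş operator is $R_{\infty,q}(f,x)=\sum_{k=0}^{\infty} f(1-q^{k})\,b_{\infty k}(q;x)$ if $x\in[0,1)$ and $R_{\infty,q}(f,1)=f(1)$, where $$b_{\infty k}(q;x)=\frac{q^{k(k-1)/2}\,(x/(1-x))^{k}}{(1-q)^{k}[k]!\prod_{j=0}^{\infty}\left(1+q^{j}\,x/(1-x)\right)}.$$ For $q=1$, $R_{\infty,1}(f)=f$. $\|\cdot\|$ is the supremum norm on $C[0,1]$.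 The second modulus of smoothness is $\omega_2(f,t)=\sup_{0\le h\le t}\ \sup_{0\le x\le 1-2h}|f(x+2h)-2f(x+h)+f(x)|$ (the suprema being over $h$ with $2h\le 1$). *)

(* Defs.v *)
From HB Require Import structures.
From mathcomp Require Import all_boot all_order all_algebra.
From mathcomp Require Import all_classical all_reals all_analysis.

Set Implicit Arguments.
Unset Strict Implicit.
Unset Printing Implicit Defensive.

Import Order.TTheory GRing.Theory Num.Theory.
Import numFieldNormedType.Exports.

Local Open Scope classical_set_scope.
Local Open Scope ring_scope.

Definition qint (R : realType) (q : R) (n : nat) : R := \sum_(i < n) q ^+ i.

Definition qfact (R : realType) (q : R) (n : nat) : R :=
  \prod_(1 <= i < n.+1) qint q i.

Definition qbinom (R : realType) (q : R) (n k : nat) : R :=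
  qfact q n / (qfact q k * qfact q (n - k)).

Definition lupas (R : realType) (n : nat) (q : R) (f : R -> R) (x : R) : R :=
  \sum_(k < n.+1)
    f (qint q k / qint q n) * qbinom q n k *
    (q ^+ (k * (k - 1) %/ 2) * x ^+ k * (1 - x) ^+ (n - k) /
     \prod_(1 <= j < n) (1 - x + q ^+ j * x)).

(* For 0 < q < 1 and 0 <= x < 1 the infinite product converges to a positive
   limit, since \sum_j q ^+ j converges. *)
Definition limit_lupas_basis (R : realType) (k : nat) (q x : R) : R :=
  q ^+ (k * (k - 1) %/ 2) * (x / (1 - x)) ^+ k /
  ((1 - q) ^+ k * qfact q k *
   limn (fun m => \prod_(0 <= j < m) (1 + q ^+ j * (x / (1 - x))))).

(* Meaningful for 0 < q <= 1 and 0 <= x <= 1. For 0 < q < 1 and 0 <= x < 1 the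
   series converges absolutely when f is bounded on [0, 1]: its basis functions
   are nonnegative and, by Euler's identity, sum to 1. *)
Definition limit_lupas (R : realType) (q : R) (f : R -> R) (x : R) : R :=
  if q == 1 then f x
  else if x == 1 then f 1
  else limn (series (fun k => f (1 - q ^+ k) * limit_lupas_basis k q x)).

(* Suprema are taken in \bar R, so that no boundedness side condition is
   hidden: the real-valued sup is 0 on unbounded sets. *)
Definition supnorm01 (R : realType) (g : R -> R) : \bar R :=
  ereal_sup [set `|g x|%:E | x in `[0, 1]].

Definition omega2 (R : realType) (f : R -> R) (t : R) : \bar R :=
  ereal_sup
    [set ereal_sup [set `|f (x + 2 * h) - 2 * f (x + h) + f x|%:E
                   | x in `[0, 1 - 2 * h]]
    | h in [set h | 0 <= h <= t /\ 2 * h <= 1]].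

(* Main.v *)
Require Import Defs.
From mathcomp Require Import all_boot all_order all_algebra.
From mathcomp Require Import all_classical all_reals all_analysis.
From mathcomp Require Import ring lra.
Set Implicit Arguments.
Unset Strict Implicit.
Unset Printing Implicit Defensive.
Import Order.TTheory GRing.Theory Num.Theory.
Import numFieldNormedType.Exports.
Local Open Scope classical_set_scope.
Local Open Scope ring_scope.

(** The degree n basis functions are combinations of those of degree n + 1, so
    that R_n f - R_(n+1) f is a mean, with the degree n + 1 basis functions as
    weights, of two-point Jensen gaps of f: each node [k]/[n+1] is a barycenter
    of [k-1]/[n] and [k]/[n]. Hence R_n reproduces affine functions, R_n g
    decreases in n when g is a hinge y |-> max(0, y - a), and the gaps of the
    square sum to at most 1/[n] - 1/[m], so R_n(y^2) - R_m(y^2) <= q^n/[n].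
    A piecewise linear interpolant of f with step d is an affine function plus
    hinges whose coefficients are at most omega_2(f, d)/d, so its error is
    bounded by the error on the interpolant of the square. Letting m tend to
    infinity gives the bound for the limit operator; for q = 1 the Bernstein
    operator is compared with point evaluation instead. *)

(** * Second differences and piecewise linear interpolation *)

(** Let [S] be the supremum of [|e|] on the cell. A second difference centred at [z], with one node
    at the nearer endpoint, where [e] vanishes, gives [2 * |e z| <= w + S], hence [S <= w]. The
    bound [M] makes [S] finite. *)
Lemma norm_le_second_difference (R : realType) (e : R -> R) (a d w M : R) :
  e a = 0 -> e (a + d) = 0 ->
  (forall z, a <= z <= a + d -> `|e z| <= M) ->
  (forall h x, 0 <= h <= d -> a <= x -> x + 2 * h <= a + d ->
     `|e (x + 2 * h) - 2 * e (x + h) + e x| <= w) ->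
  forall z, a <= z <= a + d -> `|e z| <= w.
Proof.
move=> ea eb eM ew.
pose E : set R := [set `|e z| | z in `[a, a + d]].
have inE z : a <= z <= a + d -> E `|e z|.
  by move=> zab; exists z => //=; rewrite in_itv.
have ubE : has_ubound E.
  by exists M => _ [z /= zab <-]; apply: eM; rewrite in_itv /= in zab.
(* Extrapolating [e] from the endpoint nearest to [z] through [z]. *)
have half z : a <= z <= a + d -> 2 * `|e z| <= w + sup E.
  move=> zab; have [az zb] := andP zab.
  have normM2 : 2 * `|e z| = `|2 * e z| by rewrite normrM ger0_norm.
  have [zl|zr] := leP (2 * z) (2 * a + d).
  - have h1 : `|e (a + 2 * (z - a)) - 2 * e (a + (z - a)) + e a| <= w.
      by apply: ew; lra.
    have h2 : `|e (a + 2 * (z - a))| <= sup E.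
      by apply: (ub_le_sup ubE); apply: inE; lra.
    rewrite ea addr0 (addrC a (z - a)) subrK in h1.
    rewrite normM2 -normrN.
    set v := e (a + 2 * (z - a)) in h1 h2.
    have -> : - (2 * e z) = (v - 2 * e z) - v by ring.
    by apply: le_trans (ler_normB _ _) _; apply: lerD.
  - pose h := a + d - z; pose y := z - h.
    have h1 : `|e (y + 2 * h) - 2 * e (y + h) + e y| <= w.
      by apply: ew; rewrite /y /h; lra.
    have h2 : `|e y| <= sup E.
      by apply: (ub_le_sup ubE); apply: inE; rewrite /y /h; lra.
    have Eb : y + 2 * h = a + d by rewrite /y /h; ring.
    have Ez : y + h = z by rewrite /y; ring.
    rewrite Eb Ez eb in h1.
    rewrite normM2 -normrN.
    have -> : - (2 * e z) = (0 - 2 * e z + e y) - e y by ring.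
    by apply: le_trans (ler_normB _ _) _; apply: lerD.
move=> z zab.
have supw : sup E <= (w + sup E) / 2.
  apply: ge_sup; first by exists `|e z|; apply: inE.
  move=> _ [y /= yab <-]; rewrite in_itv /= in yab.
  by have := half y yab; lra.
by have := half z zab; lra.
Qed.

Definition hinge {R : realType} (a y : R) : R := Num.max 0 (y - a).

(** Interpolation at the nodes [i * d], written as an affine function plus hinges so that a linear
    functional can be applied term by term. *)
Definition interp {R : realType} (f : R -> R) (N : nat) (d y : R) : R :=
  (f 0 + (f d - f 0) / d * y) +
  \sum_(1 <= i < N)
     (f (i.+1%:R * d) - 2 * f (i%:R * d) + f (i.-1%:R * d)) / d *
     hinge (i%:R * d) y.

Lemma interp_on_cell (R : realType) (f : R -> R) (N j : nat) (d y : R) :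
  0 < d -> (j < N)%N -> j%:R * d <= y <= j.+1%:R * d ->
  interp f N d y =
  f (j%:R * d) + (f (j.+1%:R * d) - f (j%:R * d)) / d * (y - j%:R * d).
Proof.
move=> d0 jN /andP[jy yj]; rewrite /interp.
rewrite (big_cat_nat _ (n := j.+1)) //=.
rewrite [X in _ + (_ + X)]big_nat_cond [X in _ + (_ + X)]big1; last first.
  move=> i /andP[/andP[ji _] _]; rewrite /hinge max_l ?mulr0//.
  rewrite subr_le0; apply: le_trans yj _.
  by rewrite ler_pM2r// ler_nat.
rewrite addr0 (eq_big_nat _ _ (F2 := fun i : nat =>
  (f (i.+1%:R * d) - 2 * f (i%:R * d) + f (i.-1%:R * d)) / d *
   (y - i%:R * d))); last first.
  move=> i /andP[_ ij]; rewrite /hinge max_r//.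
  rewrite subr_ge0; apply: le_trans _ jy.
  by rewrite ler_pM2r// ler_nat.
(* With the hinges replaced by linear functions the identity holds for every [y], so the cell
   hypotheses are dropped before the induction. *)
elim: j {jN jy yj} => [|j IH].
  by rewrite big_nil addr0 !mul0r subr0 mul1r.
rewrite big_nat_recr//= addrA IH.
have -> : j.+2%:R = j%:R + 2 :> R by rewrite -[in LHS]addn2 natrD.
have -> : j.+1%:R = j%:R + 1 :> R by rewrite -[in LHS]addn1 natrD.
by field; lra.
Qed.

Lemma cell_exists (R : realType) (N : nat) (d y : R) :
  0 < d -> N%:R * d = 1 -> 0 <= y <= 1 ->
  exists2 j, (j < N)%N & j%:R * d <= y <= j.+1%:R * d.
Proof.
move=> d0 Nd /andP[y0 y1].
have N0 : (0 < N)%N by case: N Nd => //; rewrite mul0r => /eqP; rewrite eq_sym oner_eq0.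
(* At [y = 1] the truncation of [y / d] is [N], one cell too far; the last cell is taken instead. *)
have [->|yn1] := eqVneq y 1.
  case: N N0 Nd => // m _ Nd; exists m => //.
  by rewrite Nd lexx andbT -[leRHS]Nd ler_pM2r// ler_nat.
have yd : 0 <= y / d by rewrite divr_ge0 // ltW.
have /andP[j1 j2] := truncn_itv yd.
exists (Num.truncn (y / d)); last first.
  by rewrite -ler_pdivlMr// j1 /= -ler_pdivrMr// ltW.
rewrite -(ltr_nat R); apply: le_lt_trans j1 _.
by rewrite ltr_pdivrMr// Nd lt_neqAle yn1.
Qed.

(** The finite real form of [omega2 f t <= w%:E]. *)
Definition second_difference_le {R : realType} (f : R -> R) (t w : R) :=
  forall h x, 0 <= h <= t -> 0 <= x -> x + 2 * h <= 1 ->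
    `|f (x + 2 * h) - 2 * f (x + h) + f x| <= w.

(** Subtracting the chord of [f] on the cell containing [y] preserves second differences and creates
    zeros at both endpoints, as [norm_le_second_difference] requires. *)
Lemma interp_error (R : realType) (f : R -> R) (N : nat) (d t w M : R) :
  0 < d -> d <= t -> N%:R * d = 1 ->
  (forall z, 0 <= z <= 1 -> `|f z| <= M) -> second_difference_le f t w ->
  forall y, 0 <= y <= 1 -> `|f y - interp f N d y| <= w.
Proof.
move=> d0 dt Nd fM fw y y01.
have [j jN yj] := cell_exists d0 Nd y01.
have dn0 : d != 0 by rewrite gt_eqF.
have jb : j.+1%:R * d <= 1 by rewrite -[leRHS]Nd ler_pM2r// ler_nat.
have j0 : 0 <= j%:R * d by rewrite mulr_ge0 // ltW.
rewrite (interp_on_cell f d0 jN yj).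
set a := j%:R * d in yj j0 *.
have Ej : j.+1%:R * d = a + d by rewrite /a -addn1 natrD mulrDl mul1r.
rewrite Ej in yj jb *.
pose e z := f z - (f a + (f (a + d) - f a) / d * (z - a)).
rewrite -/(e y).
have sl z : a <= z <= a + d -> 0 <= z <= 1 by move=> ?; lra.
pose M' := M + (M + (M + M)).
apply: (@norm_le_second_difference _ e a d w M').
- by rewrite /e; ring.
- by rewrite /e; field.
- move=> z zj; rewrite /e /M'.
  apply: le_trans (ler_normB _ _) _; apply: lerD; first exact/fM/sl.
  apply: le_trans (ler_normD _ _) _; apply: lerD; first by apply/fM/sl; lra.
  rewrite -mulrA normrM.
  have za : `|d^-1 * (z - a)| <= 1.
    rewrite ger0_norm; last by rewrite mulr_ge0 ?invr_ge0//; lra.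
    by rewrite mulrC ler_pdivrMr//; lra.
  apply: le_trans (_ : `|f (a + d) - f a| * 1 <= _).
    exact: ler_wpM2l.
  rewrite mulr1; apply: le_trans (ler_normB _ _) _.
  by apply: lerD; apply/fM/sl; lra.
- move=> h x h0 ax xb.
  have -> : e (x + 2 * h) - 2 * e (x + h) + e x =
            f (x + 2 * h) - 2 * f (x + h) + f x by rewrite /e; ring.
  by apply: fw; lra.
- exact: yj.
Qed.

(** On a cell [[a, a + d]] the excess is [(y - a) * (a + d - y)], which is [d ^+ 2 / 4] minus the
    square of the distance from [y] to the midpoint. *)
Lemma interp_sqr (R : realType) (N : nat) (d : R) :
  0 < d -> N%:R * d = 1 ->
  forall y, 0 <= y <= 1 ->
    y ^+ 2 <= interp (fun z => z ^+ 2) N d y <= y ^+ 2 + d ^+ 2 / 4.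
Proof.
move=> d0 Nd y y01.
have [j jN yj] := cell_exists d0 Nd y01.
rewrite (interp_on_cell _ d0 jN yj).
have Ej : j.+1%:R * d = j%:R * d + d by rewrite -addn1 natrD mulrDl mul1r.
rewrite Ej in yj *; set a := j%:R * d in yj *.
have -> : a ^+ 2 + ((a + d) ^+ 2 - a ^+ 2) / d * (y - a) =
          y ^+ 2 + (y - a) * (a + d - y) by field; lra.
have : 0 <= (y - a) * (a + d - y) by rewrite mulr_ge0//; lra.
have : 0 <= (y - a - d / 2) ^+ 2 by exact: sqr_ge0.
nra.
Qed.

(** * Comparison of two positive normalized functionals *)

(** An expectation over [[0, 1]]; this covers both the operators at a fixed [x] and point evaluation
    at [x]. *)
Definition mean_functional {R : realType} (A : (R -> R) -> R) :=
  [/\ forall c f g, A (fun y => c * f y + g y) = c * A f + A g,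
      forall f g, (forall y, 0 <= y <= 1 -> f y <= g y) -> A f <= A g &
      forall c, A (fun _ => c) = c].

Lemma mean_functional_ext (R : realType) (A : (R -> R) -> R) f g :
  mean_functional A -> (forall y, f y = g y) -> A f = A g.
Proof.
by case=> _ mono _ fg; apply/le_anti; rewrite !mono// => y _; rewrite fg.
Qed.

Lemma mean_functional_sub (R : realType) (A : (R -> R) -> R) f g w :
  mean_functional A -> (forall y, 0 <= y <= 1 -> `|f y - g y| <= w) ->
  `|A f - A g| <= w.
Proof.
move=> mA fgw; case: (mA) => lin mono cst.
have Ag h c : A (fun y => h y + c) = A h + c.
  rewrite -[in RHS](cst c) -[A h]mul1r -lin.
  by apply: mean_functional_ext => // y; rewrite mul1r.
have gfw : A f <= A (fun y => g y + w).
  by apply: mono => y /fgw; rewrite ler_norml; lra.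
have fgw' : A g <= A (fun y => f y + w).
  by apply: mono => y /fgw; rewrite ler_norml; lra.
by rewrite !Ag in gfw fgw'; rewrite ler_norml; lra.
Qed.

Lemma mean_functional_interp (R : realType) (A : (R -> R) -> R) f N d :
  mean_functional A ->
  A (interp f N d) = f 0 + (f d - f 0) / d * A id +
  \sum_(1 <= i < N)
     (f (i.+1%:R * d) - 2 * f (i%:R * d) + f (i.-1%:R * d)) / d *
     A (hinge (i%:R * d)).
Proof.
move=> mA; case: (mA) => lin mono cst.
have base : A (fun y => f 0 + (f d - f 0) / d * y) =
            f 0 + (f d - f 0) / d * A id.
  have -> : f 0 + (f d - f 0) / d * A id =
            (f d - f 0) / d * A id + A (fun _ => f 0) by rewrite cst addrC.
  rewrite -lin.
  by apply: mean_functional_ext => // y; rewrite addrC.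
elim: N => [|[|N] IH].
- rewrite big_geq// addr0 -base; apply: mean_functional_ext => // y.
  by rewrite /interp big_geq// addr0.
- rewrite big_geq// addr0 -base; apply: mean_functional_ext => // y.
  by rewrite /interp big_geq// addr0.
- rewrite [in RHS]big_nat_recr//= addrA -IH [in RHS]addrC -lin.
  apply: mean_functional_ext => // y.
  by rewrite /interp big_nat_recr//= addrA addrC.
Qed.

(* Since the second differences of [f] are dominated by those of a multiple of
   the square function, the error on the interpolant of [f] is controlled by the
   error on the interpolant of the square, term by term in the hinges. *)
Lemma mean_functional_compare (R : realType) (A B : (R -> R) -> R) f t w M :
  mean_functional A -> mean_functional B -> A id = B id ->
  (forall a, B (hinge a) <= A (hinge a)) ->
  A (fun y => y ^+ 2) - B (fun y => y ^+ 2) <= t ^+ 2 ->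
  0 < t <= 1 -> 0 <= w ->
  (forall z, 0 <= z <= 1 -> `|f z| <= M) -> second_difference_le f t w ->
  `|A f - B f| <= 5 * w.
Proof.
move=> mA mB AB1 ABh AB2 /andP[t0 t1] w0 fM fw.
(* The reciprocal of an integer, so that the nodes end at 1; this choice gives [d <= t <= 2 * d]. *)
pose N := (Num.truncn t^-1).+1; pose d : R := N%:R^-1.
have ti0 : 0 <= t^-1 by rewrite invr_ge0 ltW.
have /andP[N1 N2] := truncn_itv ti0; rewrite -/N in N2.
have N0 : 0 < N%:R :> R by rewrite ltr0n.
have d0 : 0 < d by rewrite invr_gt0.
have dn0 : d != 0 by rewrite gt_eqF.
have dt : d <= t by rewrite -[t]invrK lef_pV2 ?posrE ?invr_gt0// ltW.
have Nd : N%:R * d = 1 by rewrite mulfV// gt_eqF.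
have td : t <= 2 * d.
  have : N%:R <= 2 / t.
    have : 1 <= t^-1 by rewrite invf_ge1.
    by rewrite /N -addn1 natrD; lra.
  rewrite ler_pdivlMr// => Nt.
  by rewrite -(ler_pM2l N0) mulrCA Nd mulr1.
have eA := mean_functional_sub mA (interp_error d0 dt Nd fM fw).
have eB := mean_functional_sub mB (interp_error d0 dt Nd fM fw).
pose H i := A (hinge (i%:R * d)) - B (hinge (i%:R * d)).
have H0 i : 0 <= H i by rewrite subr_ge0.
(* The second differences of the square all equal [2 * d ^+ 2], so each hinge has coefficient
   [2 * d]; the affine parts cancel because [A id = B id]. *)
have sq : 2 * d * \sum_(1 <= i < N) H i <= t ^+ 2 + d ^+ 2 / 4.
  have sqA := mean_functional_interp (fun z => z ^+ 2) N d mA.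
  have sqB := mean_functional_interp (fun z => z ^+ 2) N d mB.
  have up : A (interp (fun z => z ^+ 2) N d) <=
            A (fun y => y ^+ 2) + d ^+ 2 / 4.
    case: (mA) => lin mono cst; rewrite -(cst (d ^+ 2 / 4)).
    rewrite -[A (fun y => y ^+ 2)]mul1r -lin.
    by apply: mono => y /(interp_sqr d0 Nd)/andP[_]; rewrite mul1r.
  have low : B (fun y => y ^+ 2) <= B (interp (fun z => z ^+ 2) N d).
    by case: (mB) => _ mono _; apply: mono => y /(interp_sqr d0 Nd)/andP[].
  have -> : 2 * d * \sum_(1 <= i < N) H i =
     A (interp (fun z => z ^+ 2) N d) - B (interp (fun z => z ^+ 2) N d).
    rewrite sqA sqB AB1 opprD addrACA subrr add0r -sumrB mulr_sumr.
    apply: eq_big_nat => -[//|i] _; rewrite /H/=.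
    have -> : i.+2%:R = i%:R + 2 :> R by rewrite -[in LHS]addn2 natrD.
    have -> : i.+1%:R = i%:R + 1 :> R by rewrite -[in LHS]addn1 natrD.
    by field.
  lra.
have mid : `|A (interp f N d) - B (interp f N d)| <=
           w / d * \sum_(1 <= i < N) H i.
  rewrite !mean_functional_interp// AB1.
  rewrite opprD addrACA subrr add0r -sumrB mulr_sumr.
  apply: le_trans (ler_norm_sum _ _ _) _.
  apply: ler_sum_nat => -[//|i] /andP[_ iN] /=.
  rewrite -mulrBr -/(H i.+1) normrM (ger0_norm (H0 _)).
  apply: ler_wpM2r (H0 _) _ _ _.
  rewrite normrM (gtr0_norm (_ : 0 < d^-1)) ?invr_gt0//.
  apply: ler_wpM2r; first by rewrite invr_ge0 ltW.
  have := fw d (i%:R * d).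
  have -> : i%:R * d + 2 * d = i.+2%:R * d.
    by rewrite -mulrDl -[i.+2]addn2 natrD.
  have -> : i%:R * d + d = i.+1%:R * d.
    by rewrite -[i.+1]addn1 natrD mulrDl mul1r.
  apply => //.
  - by rewrite ltW.
  - by rewrite mulr_ge0// ltW.
  - by rewrite -[leRHS]Nd ler_pM2r// ler_nat.
(* From [t <= 2 * d], [t ^+ 2 + d ^+ 2 / 4] is at most [17 / 4 * d ^+ 2], below
   [2 * d * (3 * d)]. *)
have sumH : \sum_(1 <= i < N) H i <= 3 * d.
  rewrite -(ler_pM2l (_ : 0 < 2 * d)); last by lra.
  apply: le_trans sq _; nra.
have mid3 : `|A (interp f N d) - B (interp f N d)| <= 3 * w.
  apply: le_trans mid _; apply: le_trans (_ : w / d * (3 * d) <= _).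
    by apply: ler_wpM2l => //; rewrite divr_ge0// ltW.
  by rewrite le_eqVlt; apply/orP; left; apply/eqP; field.
(* Two interpolation errors of [w] each and [3 * w] between the interpolants make [5 * w]. *)
move: eA eB mid3; rewrite !ler_norml; lra.
Qed.

(** * q-integers and q-factorials *)

Lemma qint0 (R : realType) (q : R) : qint q 0 = 0.
Proof. exact: big_ord0. Qed.

Lemma qint1 (R : realType) (q : R) : qint q 1 = 1.
Proof. by rewrite /qint big_ord1 expr0. Qed.

Lemma qintS (R : realType) (q : R) n : qint q n.+1 = qint q n + q ^+ n.
Proof. exact: big_ord_recr. Qed.

Lemma qintD (R : realType) (q : R) m n :
  qint q (m + n) = qint q m + q ^+ m * qint q n.
Proof.
elim: n => [|n IH]; first by rewrite addn0 qint0 mulr0 addr0.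
by rewrite addnS !qintS IH exprD; ring.
Qed.

Lemma qint_ge0 (R : realType) (q : R) n : 0 <= q -> 0 <= qint q n.
Proof. by move=> q0; apply: sumr_ge0 => i _; rewrite exprn_ge0. Qed.

Lemma qint_le (R : realType) (q : R) m n :
  0 <= q -> (m <= n)%N -> qint q m <= qint q n.
Proof.
move=> q0 /subnKC <-.
by rewrite qintD lerDl mulr_ge0 ?exprn_ge0 ?qint_ge0.
Qed.

Lemma qint_gt0 (R : realType) (q : R) n : 0 < q -> (0 < n)%N -> 0 < qint q n.
Proof.
move=> q0 n0; apply: lt_le_trans (qint_le (ltW q0) n0).
by rewrite qint1.
Qed.

(** Each of the [n] summands is at least [q ^+ n]. This is what bounds [q ^+ n / [n]] by [1 / n]
    uniformly in [q]. *)
Lemma qint_ge_expn (R : realType) (q : R) n :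
  0 <= q <= 1 -> n%:R * q ^+ n <= qint q n.
Proof.
move=> /andP[q0 q1]; rewrite mulr_natl -[n in _ *+ n]card_ord -sumr_const.
apply: ler_sum => i _; apply: ler_wiXn2l => //; exact: ltnW.
Qed.

Lemma qintE (R : realType) (q : R) n : (1 - q) * qint q n = 1 - q ^+ n.
Proof.
elim: n => [|n IH]; first by rewrite qint0 expr0; ring.
by rewrite qintS mulrDr IH exprS; ring.
Qed.

Lemma qfactS (R : realType) (q : R) n :
  qfact q n.+1 = qfact q n * qint q n.+1.
Proof. by rewrite /qfact big_nat_recr. Qed.

Lemma qfact_gt0 (R : realType) (q : R) n : 0 < q -> 0 < qfact q n.
Proof.
move=> q0; elim: n => [|n IH]; first by rewrite /qfact big_geq.
by rewrite qfactS mulr_gt0 ?qint_gt0.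
Qed.

Lemma bin2_divE k : (k * (k - 1) %/ 2 = 'C(k, 2))%N.
Proof. by rewrite bin2 divn2 subn1. Qed.

(** * Degree raising for the basis functions *)

Definition lupas_basis {R : realType} (n : nat) (q x : R) (k : nat) : R :=
  qbinom q n k *
  (q ^+ (k * (k - 1) %/ 2) * x ^+ k * (1 - x) ^+ (n - k) /
   \prod_(1 <= j < n) (1 - x + q ^+ j * x)).

Lemma lupasE (R : realType) n (q : R) f x :
  lupas n q f x =
  \sum_(k < n.+1) f (qint q k / qint q n) * lupas_basis n q x k.
Proof. by apply: eq_bigr => k _; rewrite -mulrA. Qed.

Lemma lupas_factor_gt0 (R : realType) (q x : R) j :
  0 < q -> 0 <= x <= 1 -> 0 < 1 - x + q ^+ j * x.
Proof.
move=> q0 /andP[x0 x1]; have qj : 0 < q ^+ j by rewrite exprn_gt0.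
have [->|xn0] := eqVneq x 0; first by lra.
have : 0 < q ^+ j * x by rewrite mulr_gt0 // lt_neqAle eq_sym xn0.
by lra.
Qed.

Lemma lupas_denom_gt0 (R : realType) (q x : R) n :
  0 < q -> 0 <= x <= 1 -> 0 < \prod_(1 <= j < n) (1 - x + q ^+ j * x).
Proof. by move=> q0 x01; apply: prodr_gt0 => j _; exact: lupas_factor_gt0. Qed.

Lemma qbinom_gt0 (R : realType) (q : R) n k : 0 < q -> 0 < qbinom q n k.
Proof. by move=> q0; rewrite divr_gt0 ?mulr_gt0 ?qfact_gt0. Qed.

Lemma lupas_basis_ge0 (R : realType) (q x : R) n k :
  0 < q -> 0 <= x <= 1 -> 0 <= lupas_basis n q x k.
Proof.
move=> q0 x01; have /andP[x0 x1] := x01.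
apply: mulr_ge0; first exact/ltW/qbinom_gt0.
rewrite divr_ge0 ?(ltW (lupas_denom_gt0 _ q0 x01))//.
by rewrite !mulr_ge0 ?exprn_ge0 ?subr_ge0// ltW.
Qed.

(* [stay_weight q n k] and [step_weight q n k] are the coefficients of the node
   [k]/[n+1] as a barycenter of [k]/[n] and [k-1]/[n]. *)
Definition stay_weight {R : realType} (q : R) (n k : nat) : R :=
  qint q (n.+1 - k) / qint q n.+1.

Definition step_weight {R : realType} (q : R) (n k : nat) : R :=
  q ^+ (n.+1 - k) * qint q k / qint q n.+1.

(** The quotient on the right and the one in [lupas_basis_step] add up to 1, so the two lemmas
    together split a degree [n] basis function over the indices [k] and [k.+1] in degree [n.+1]. *)
Lemma lupas_basis_stay (R : realType) (q x : R) n k :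
  0 < q -> 0 <= x <= 1 -> (0 < n)%N -> (k <= n)%N ->
  stay_weight q n k * lupas_basis n.+1 q x k =
  (1 - x) / (1 - x + q ^+ n * x) * lupas_basis n q x k.
Proof.
move=> q0 x01 n0 kn; rewrite /stay_weight /lupas_basis /qbinom.
rewrite big_nat_recr//= subSn// !qfactS exprS.
have := lupas_denom_gt0 n q0 x01; set D := \prod_(_ <= _ < _) _ => D0.
have := lupas_factor_gt0 n q0 x01.
have := qint_gt0 q0 (ltn0Sn n); have := qint_gt0 q0 (ltn0Sn (n - k)).
have := qfact_gt0 k q0; have := qfact_gt0 (n - k) q0.
move=> a b c d e; field; rewrite !gt_eqF//.
Qed.

Lemma lupas_basis_step (R : realType) (q x : R) n k :
  0 < q -> 0 <= x <= 1 -> (0 < n)%N -> (k <= n)%N ->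
  step_weight q n k.+1 * lupas_basis n.+1 q x k.+1 =
  q ^+ n * x / (1 - x + q ^+ n * x) * lupas_basis n q x k.
Proof.
move=> q0 x01 n0 kn; rewrite /step_weight /lupas_basis /qbinom.
rewrite big_nat_recr//= subSS !qfactS exprS !bin2_divE binS bin1 exprD.
have := lupas_denom_gt0 n q0 x01; set D := \prod_(_ <= _ < _) _ => D0.
(* The factor [q ^+ (n - k)] comes from the step weight, and [q ^+ k] from Pascal's rule in the
   exponent. *)
have -> : q ^+ n = q ^+ (n - k) * q ^+ k by rewrite -exprD subnK.
have := lupas_factor_gt0 n q0 x01.
have -> : q ^+ n = q ^+ (n - k) * q ^+ k by rewrite -exprD subnK.
have := qint_gt0 q0 (ltn0Sn n); have := qint_gt0 q0 (ltn0Sn k).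
have := qfact_gt0 k q0; have := qfact_gt0 (n - k) q0.
move=> a b c d e; field; rewrite !gt_eqF//.
Qed.

Lemma step_weight0 (R : realType) (q : R) n : step_weight q n 0 = 0.
Proof. by rewrite /step_weight qint0 mulr0 mul0r. Qed.

Lemma stay_weightn (R : realType) (q : R) n : stay_weight q n n.+1 = 0.
Proof. by rewrite /stay_weight subnn qint0 mul0r. Qed.

Lemma sum_lupas_basisS (R : realType) (q x : R) n (F : nat -> R) :
  0 < q -> 0 <= x <= 1 -> (0 < n)%N ->
  \sum_(k < n.+1) F k * lupas_basis n q x k =
  \sum_(k < n.+2) (stay_weight q n k * F k + step_weight q n k * F k.-1) *
                  lupas_basis n.+1 q x k.
Proof.
move=> q0 x01 n0.
under [RHS]eq_bigr => k _ do rewrite mulrDl.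
rewrite big_split /=.
(* Both boundary terms vanish: the stay weight at [n.+1] and the step weight at 0, which also
   neutralizes the default [0.-1 = 0]. *)
rewrite [X in _ = X + _]big_ord_recr /= stay_weightn !mul0r addr0.
rewrite [X in _ = _ + X]big_ord_recl /= step_weight0 !mul0r add0r.
rewrite -big_split /=; apply: eq_bigr => k _.
rewrite /bump /= add1n.
have kn : (k <= n)%N by rewrite -ltnS.
rewrite mulrAC lupas_basis_stay// [X in _ = _ + X]mulrAC lupas_basis_step//.
have := lupas_factor_gt0 n q0 x01 => D0.
by field; rewrite gt_eqF.
Qed.

Lemma weight_sum (R : realType) (q : R) n k :
  0 < q -> (k <= n.+1)%N -> stay_weight q n k + step_weight q n k = 1.
Proof.
move=> q0 kn; rewrite /stay_weight /step_weight -mulrDl -qintD subnK//.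
by rewrite divff// gt_eqF// qint_gt0.
Qed.

(** After a common factor is taken out, the case of index [k.+1] is [[n] = [n - k] + q ^+ (n - k) *
    [k]]. *)
Lemma weight_mean (R : realType) (q : R) n k :
  0 < q -> (0 < n)%N -> (k <= n.+1)%N ->
  stay_weight q n k * (qint q k / qint q n) +
  step_weight q n k * (qint q k.-1 / qint q n) = qint q k / qint q n.+1.
Proof.
move=> q0 n0; case: k => [|k] kn; first by rewrite step_weight0 qint0; ring.
rewrite /stay_weight /step_weight /=.
have : qint q n = qint q (n.+1 - k.+1) + q ^+ (n.+1 - k.+1) * qint q k.
  by rewrite -qintD subSS subnK.
have := qint_gt0 q0 n0; have := qint_gt0 q0 (ltn0Sn n).
set a := qint q n; set b := qint q n.+1; set c := qint q (_ - _).
set d := qint q k.+1; set e := qint q k => b0 a0 abc.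
have -> : c / b * (d / a) + q ^+ (n.+1 - k.+1) * d / b * (e / a) =
  d / (a * b) * (c + q ^+ (n.+1 - k.+1) * e) by field; rewrite !gt_eqF.
by rewrite -abc; field; rewrite !gt_eqF.
Qed.

Lemma stay_weight_ge0 (R : realType) (q : R) n k :
  0 < q -> 0 <= stay_weight q n k.
Proof. by move=> q0; rewrite divr_ge0 ?qint_ge0 // ltW. Qed.

Lemma step_weight_ge0 (R : realType) (q : R) n k :
  0 < q -> 0 <= step_weight q n k.
Proof. by move=> q0; rewrite divr_ge0 ?mulr_ge0 ?exprn_ge0 ?qint_ge0// ltW. Qed.

(** Degree raising with a constant [F] keeps the sum, because the weights add up to 1; degree 1 is
    computed directly. *)
Lemma sum_lupas_basis (R : realType) (q x : R) n :
  0 < q -> 0 <= x <= 1 -> (0 < n)%N -> \sum_(k < n.+1) lupas_basis n q x k = 1.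
Proof.
move=> q0 x01; case: n => // n _; elim: n => [|n IH].
  rewrite big_ord_recr big_ord1 /= /lupas_basis /qbinom.
  rewrite big_geq// !qfactS /qfact big_geq// qint1 !expr0 !expr1.
  by rewrite /=; field.
rewrite -[RHS]IH.
under [RHS]eq_bigr do rewrite -[lupas_basis _ _ _ _]mul1r.
rewrite (sum_lupas_basisS (fun=> 1))//.
by apply: eq_bigr => k _; rewrite !mulr1 weight_sum ?mul1r// -ltnS.
Qed.

Lemma mean_functional_lupas (R : realType) (q x : R) n :
  0 < q -> 0 <= x <= 1 -> (0 < n)%N -> mean_functional (fun f => lupas n q f x).
Proof.
move=> q0 x01 n0; split.
- move=> c f g; rewrite !lupasE mulr_sumr -big_split; apply: eq_bigr => k _ /=.
  by ring.
- move=> f g fg; rewrite !lupasE; apply: ler_sum => k _.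
  apply: ler_wpM2r; first exact: lupas_basis_ge0.
  apply: fg; rewrite divr_ge0 ?qint_ge0 ?(ltW q0)//= ler_pdivrMr ?qint_gt0//.
  by rewrite mul1r qint_le ?(ltW q0)// -ltnS.
- by move=> c; rewrite lupasE -mulr_sumr sum_lupas_basis ?mulr1.
Qed.

Lemma lupas_id (R : realType) (q x : R) n :
  0 < q -> 0 <= x <= 1 -> (0 < n)%N -> lupas n q id x = x.
Proof.
move=> q0 x01; case: n => // n _; elim: n => [|n IH].
  rewrite lupasE big_ord_recr big_ord1 /= qint0 qint1 !mul0r add0r.
  rewrite /lupas_basis /qbinom big_geq// !qfactS /qfact big_geq// qint1.
  by rewrite !expr0 !expr1 /=; field.
rewrite -[RHS]IH !lupasE (sum_lupas_basisS (fun k => qint q k / qint q n.+1))//.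
by apply: eq_bigr => k _; rewrite weight_mean// -ltnS.
Qed.

(** * Monotonicity on hinges and second moments *)

Lemma hinge_convex (R : realType) (a u v y z : R) :
  0 <= u -> 0 <= v -> u + v = 1 ->
  hinge a (u * y + v * z) <= u * hinge a y + v * hinge a z.
Proof.
move=> u0 v0 uv; rewrite /hinge ge_max; apply/andP; split.
  by rewrite addr_ge0// mulr_ge0// le_max lexx.
have -> : u * y + v * z - a = u * (y - a) + v * (z - a).
  by rewrite -[a in LHS]mul1r -uv; ring.
by apply: lerD; apply: ler_wpM2l => //; rewrite le_max lexx orbT.
Qed.

Lemma lupas_hinge_noninc (R : realType) (q x a : R) n m :
  0 < q -> 0 <= x <= 1 -> (0 < n)%N -> (n <= m)%N ->
  lupas m q (hinge a) x <= lupas n q (hinge a) x.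
Proof.
move=> q0 x01 n0 /subnKC <-; elim: (m - n)%N => [|p IH]; first by rewrite addn0.
apply: le_trans IH; rewrite addnS !lupasE.
have np0 : (0 < n + p)%N by rewrite addn_gt0 n0.
rewrite (sum_lupas_basisS (fun k => hinge a (qint q k / qint q (n + p))))//.
apply: ler_sum => k _; apply: ler_wpM2r; first exact: lupas_basis_ge0.
have kn : (k <= (n + p).+1)%N by rewrite -ltnS.
rewrite -weight_mean//; apply: hinge_convex; last exact: weight_sum.
- exact: stay_weight_ge0.
- exact: step_weight_ge0.
Qed.

(** The two-point Jensen gap of the square is the product of the weights and the squared node
    distance [q ^+ k / [n]]. It is at most [q ^+ n / ([n] * [n+1])], which equals [1 / [n] - 1 /
    [n+1]]. *)
Lemma lupas_sqr_step (R : realType) (q x : R) n :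
  0 < q <= 1 -> 0 <= x <= 1 -> (0 < n)%N ->
  lupas n q (fun y => y ^+ 2) x - lupas n.+1 q (fun y => y ^+ 2) x <=
  (qint q n)^-1 - (qint q n.+1)^-1.
Proof.
move=> /andP[q0 q1] x01 n0; rewrite !lupasE.
rewrite (sum_lupas_basisS (fun k => (qint q k / qint q n) ^+ 2))//.
rewrite -sumrB.
rewrite -[leRHS]mulr1 -(sum_lupas_basis q0 x01 (ltn0Sn n)) mulr_sumr.
apply: ler_sum => k _; rewrite -mulrBl; apply: ler_wpM2r.
  exact: lupas_basis_ge0.
have kn : (k <= n.+1)%N by rewrite -ltnS.
rewrite -weight_mean//.
have := weight_sum q0 kn.
case: k kn => -[|k] /= _ kn.
  rewrite step_weight0 qint0 !mul0r expr2 !mulr0 !addr0 expr2 mulr0 subrr => _.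
  by rewrite subr_ge0 lef_pV2 ?posrE ?qint_gt0// qint_le// ltW.
have a0 := qint_gt0 q0 n0; have b0 := qint_gt0 q0 (ltn0Sn n).
set v := stay_weight _ _ _; set w := step_weight _ _ _.
set a := qint q n in a0 *; set b := qint q n.+1 in b0 *.
move=> vw.
have -> : v * (qint q k.+1 / a) ^+ 2 + w * (qint q k / a) ^+ 2 -
   (v * (qint q k.+1 / a) + w * (qint q k / a)) ^+ 2 =
   v * w * (q ^+ k / a) ^+ 2.
  rewrite qintS; have -> : v = 1 - w by rewrite -vw addrK.
  by field; rewrite gt_eqF.
have -> : a^-1 - b^-1 = q ^+ n / (a * b).
  have -> : b = a + q ^+ n by rewrite /a /b qintS.
  by field; rewrite /a -qintS !gt_eqF.
rewrite /v /w /stay_weight /step_weight -/b subSS.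
(* The powers of [q] are regrouped to leave two ratios of q-integers in [[0, 1]] and the factor
   [q ^+ k * q ^+ n / (a * b)]. *)
have -> : qint q (n - k) / b * (q ^+ (n - k) * qint q k.+1 / b) *
          (q ^+ k / a) ^+ 2 =
  (qint q (n - k) / a) * (qint q k.+1 / b) * (q ^+ k * (q ^+ (n - k) * q ^+ k) / (a * b)).
  by field; rewrite !gt_eqF.
rewrite -exprD subnK//.
have in01 (c d : R) : 0 <= c -> 0 < d -> c <= d -> 0 <= c / d <= 1.
  by move=> c0 d0 cd; rewrite divr_ge0 ?(ltW d0)//= ler_pdivrMr// mul1r.
have /andP[t0 t1] : 0 <= qint q (n - k) / a <= 1.
  by apply: in01 => //; [exact/qint_ge0/ltW | rewrite qint_le ?(ltW q0)// leq_subr].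
have /andP[s0 s1] : 0 <= qint q k.+1 / b <= 1.
  by apply: in01 => //; [exact/qint_ge0/ltW | rewrite qint_le ?(ltW q0)].
rewrite -[leRHS]mul1r; apply: ler_pM.
- exact: mulr_ge0.
- by rewrite divr_ge0 ?mulr_ge0 ?exprn_ge0 ?(ltW q0) ?(ltW a0) ?(ltW b0).
- exact: mulr_ile1.
- apply: ler_wpM2r; first by rewrite invr_ge0 mulr_ge0 ?(ltW a0) ?(ltW b0).
  by rewrite ler_piMl ?exprn_ge0 ?exprn_ile1 ?(ltW q0).
Qed.

(** The steps telescope to [1 / [n] - 1 / [m] = q ^+ n / [n] * ([m - n] / [m])], and the last ratio
    is at most 1. *)
Lemma lupas_sqr_gap (R : realType) (q x : R) n m :
  0 < q <= 1 -> 0 <= x <= 1 -> (0 < n)%N -> (n <= m)%N ->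
  lupas n q (fun y => y ^+ 2) x - lupas m q (fun y => y ^+ 2) x <=
  q ^+ n / qint q n.
Proof.
move=> q01 x01 n0 nm; have /andP[q0 q1] := q01.
apply: le_trans (_ : (qint q n)^-1 - (qint q m)^-1 <= _).
  rewrite -(subnKC nm); elim: (m - n)%N => [|p IH].
    by rewrite addn0 !subrr.
  rewrite addnS; have np : (0 < n + p)%N by rewrite addn_gt0 n0.
  by have := lupas_sqr_step q01 x01 np; lra.
have a0 := qint_gt0 q0 n0; have b0 := qint_gt0 q0 (leq_trans n0 nm).
have E : qint q m = qint q n + q ^+ n * qint q (m - n) by rewrite -qintD subnKC.
have -> : (qint q n)^-1 - (qint q m)^-1 =
   q ^+ n / qint q n * (qint q (m - n) / qint q m).
  rewrite [in RHS]mulrACA -[q ^+ n * _](addKr (qint q n)) -E.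
  by field; rewrite !gt_eqF.
rewrite ler_piMr ?divr_ge0 ?exprn_ge0 ?(ltW q0) ?(ltW a0)//.
by rewrite ler_pdivrMr// mul1r qint_le ?(ltW q0)// leq_subr.
Qed.

Lemma bernstein_sqr (R : realType) (x : R) n :
  0 <= x <= 1 -> (0 < n)%N ->
  lupas n 1 (fun y => y ^+ 2) x = x ^+ 2 + x * (1 - x) / n%:R.
Proof.
(* The recursion does not determine the second moment at n = 2 from that at
   n = 1, whence the separate base case. *)
move=> x01; case: n => // n _.
have qintn k : qint (1 : R) k = k%:R.
  by rewrite /qint (eq_bigr (fun=> 1)) ?sumr_const ?card_ord// => i; rewrite expr1n.
case: n => [|n].
  rewrite lupasE big_ord_recr big_ord1 /= /lupas_basis /qbinom big_geq//.
  rewrite !qfactS /qfact big_geq// qint0 qint1 !expr0 !expr1 /=.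
  by field.
elim: n => [|n IH].
  rewrite lupasE !big_ord_recr big_ord0 /= /lupas_basis /qbinom.
  rewrite !bin2_divE !big_nat1 !qfactS /qfact big_geq// !qintn /= !expr1n.
  by field; lra.
have one0 : 0 < 1 :> R by [].
have S := sum_lupas_basisS (fun k => (k%:R / n.+2%:R) ^+ 2) one0 x01 (ltn0Sn n.+1).
have mean := lupas_id one0 x01 (ltn0Sn n.+2).
rewrite lupasE in mean.
rewrite lupasE in IH.
have E1 : \sum_(k < n.+3) (k%:R / n.+2%:R) ^+ 2 * lupas_basis n.+2 1 x k =
  x ^+ 2 + x * (1 - x) / n.+2%:R.
  by rewrite -IH; apply: eq_bigr => k _; rewrite !qintn.
rewrite E1 in S.
(* At [q = 1], raising the squared nodes yields a combination of the squared nodes and the nodes of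
   the next degree, whose mean is [x]. *)
have E2 : x ^+ 2 + x * (1 - x) / n.+2%:R =
  (1 - (n.+2%:R ^+ 2)^-1) * lupas n.+3 1 (fun y => y ^+ 2) x +
  (n.+2%:R ^+ 2)^-1 * x.
  rewrite S lupasE -[X in _ = _ + _ * X]mean !mulr_sumr -big_split.
  apply: eq_bigr => k _ /=.
  rewrite !qintn /stay_weight /step_weight !qintn expr1n.
  have kn : (k <= n.+3)%N by rewrite -ltnS.
  rewrite natrB//.
  have n0 : 0 <= n%:R :> R by [].
  have -> : n.+3%:R = n%:R + 3 :> R by rewrite -[in LHS]addn3 natrD.
  have -> : n.+2%:R = n%:R + 2 :> R by rewrite -[in LHS]addn2 natrD.
  case: k {kn} => -[|k] _ /=; first by field; lra.
  have -> : k.+1%:R = k%:R + 1 :> R by rewrite -[in LHS]addn1 natrD.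
  by field; lra.
have n0 : 0 <= n%:R :> R by [].
have E3 : n.+3%:R = n%:R + 3 :> R by rewrite -[in LHS]addn3 natrD.
have E4 : n.+2%:R = n%:R + 2 :> R by rewrite -[in LHS]addn2 natrD.
rewrite E3; rewrite E4 in E2.
set L := lupas _ _ _ _ in E2 *.
(* The leading coefficient is nonzero since [n + 2 > 1], so the relation can be solved for the
   second moment of the next degree. *)
have c0 : 1 - ((n%:R + 2) ^+ 2)^-1 != 0 :> R.
  rewrite gt_eqF// subr_gt0 invf_lt1; nra.
apply: (mulfI c0); apply: (addIr (((n%:R + 2) ^+ 2)^-1 * x)).
rewrite -E2; field; lra.
Qed.

(** * Limits of sequences and series *)

Lemma cvgn_le_cst (R : realType) (u : nat -> R) l c :
  u m @[m --> \oo] --> l -> (\forall m \near \oo, u m <= c) -> l <= c.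
Proof.
move=> ul uc; rewrite -(cvg_lim (@Rhausdorff R) ul).
by apply: limr_le => //; exact: cvgP ul.
Qed.

Lemma cvgn_ge_cst (R : realType) (u : nat -> R) l c :
  u m @[m --> \oo] --> l -> (\forall m \near \oo, c <= u m) -> c <= l.
Proof.
move=> ul uc; rewrite -(cvg_lim (@Rhausdorff R) ul).
by apply: limr_ge => //; exact: cvgP ul.
Qed.

Lemma cvg_sum_nat (R : realType) (T : nat -> nat -> R) (t : nat -> R) N :
  (forall k, T m k @[m --> \oo] --> t k) ->
  \sum_(0 <= k < N) T m k @[m --> \oo] --> \sum_(0 <= k < N) t k.
Proof.
move=> Tt; elim: N => [|N IH].
  under eq_fun do rewrite big_geq//.
  by rewrite big_geq//; exact: cvg_cst.
under eq_fun do rewrite big_nat_recr//=.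
by rewrite big_nat_recr//=; exact: cvgD.
Qed.

(* Tannery's theorem, that is, dominated convergence for series. *)
Lemma cvg_sum_dominated (R : realType) (T : nat -> nat -> R) (t G : nat -> R) :
  (forall k, T m k @[m --> \oo] --> t k) ->
  (\forall m \near \oo, forall k, (k <= m)%N -> `|T m k| <= G k) ->
  cvgn (series G) ->
  \sum_(0 <= k < m.+1) T m k @[m --> \oo] --> limn (series t).
Proof.
move=> Tt TG cG.
have tG k : `|t k| <= G k.
  apply: cvgn_le_cst (cvg_norm (Tt k)) _.
  by near=> m; near: m; apply: filterS2 TG (nbhs_infty_ge k) => m; apply.
have ct : cvgn (series t).
  apply: normed_cvg; apply: series_le_cvg cG => //= n.
  exact: le_trans (normr_ge0 _) (tG n).
pose L := limn (series G).
have homG : {homo series G : i j / (i <= j)%N >-> i <= j}.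
  move=> i j ij; rewrite -subr_ge0 sub_series_geq//.
  by apply: sumr_ge0 => k _; exact: le_trans (normr_ge0 _) (tG k).
have sumG m n : \sum_(m <= k < n) G k <= L - series G m.
  have [mn|nm] := leqP m n.
    by rewrite -sub_series_geq// lerB// nondecreasing_cvgn_le.
  by rewrite big_geq ?(ltnW nm)// subr_ge0 nondecreasing_cvgn_le.
apply/cvgrPdist_le => e e0.
have e4 : 0 < e / 4 by rewrite divr_gt0.
(* Beyond the cut [N] the tail of [G] is at most [e / 4]; the tails of both sums and the difference
   of their heads then cost [e / 4] each. *)
have [N _ NG] : \forall N \near \oo, L - series G N <= e / 4.
  move/cvgrPdist_le : cG => /(_ _ e4); apply: filterS => n.
  exact: le_trans (ler_norm _).
have {}NG := NG N (leqnn N); rewrite /= in NG.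
have tailt : `|limn (series t) - series t N| <= e / 4.
  have cvgtail : `|series t m - series t N| @[m --> \oo] -->
                 `|limn (series t) - series t N|.
    by apply: cvg_norm; apply: cvgB => //; exact: cvg_cst.
  apply: cvgn_le_cst cvgtail _; near=> m.
  have Nm : (N <= m)%N by near: m; exact: nbhs_infty_ge.
  rewrite sub_series_geq//.
  apply: le_trans (ler_norm_sum _ _ _) _.
  apply: le_trans (ler_sum_nat _) _; first by move=> k _; exact: tG.
  exact: le_trans (sumG _ _) NG.
have head : \forall m \near \oo,
    `|series t N - \sum_(0 <= k < N) T m k| <= e / 4.
  by have /cvgrPdist_le/(_ _ e4) := cvg_sum_nat (N := N) Tt.
near=> m.
have Nm : (N <= m.+1)%N.
  by apply: leqW; near: m; exact: nbhs_infty_ge.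
rewrite (big_cat_nat _ (n := N))//=.
have tailT : `|\sum_(N <= k < m.+1) T m k| <= e / 4.
  apply: le_trans (ler_norm_sum _ _ _) _.
  apply: le_trans (_ : \sum_(N <= k < m.+1) G k <= _).
    apply: ler_sum_nat => k /andP[_ km]; rewrite ltnS in km.
    by move: k km; near: m.
  exact: le_trans (sumG _ _) NG.
have hm : `|series t N - \sum_(0 <= k < N) T m k| <= e / 4 by near: m.
by move: tailt tailT hm; rewrite !ler_norml; lra.
Unshelve. all: by end_near. Qed.

(** * Convergence of the basis functions *)

Lemma cvg_qint (R : realType) (q : R) :
  0 < q < 1 -> qint q m @[m --> \oo] --> (1 - q)^-1.
Proof.
move=> /andP[q0 q1].
have nq : `|q| < 1 by rewrite gtr0_norm.
have := @cvg_geometric_series R 1 q nq; rewrite mul1r.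
apply: cvg_trans; apply: near_eq_cvg; near=> m.
by rewrite /series /qint /= big_mkord; apply: eq_bigr => i _; rewrite mul1r.
Unshelve. all: by end_near. Qed.

Lemma qint_le_lim (R : realType) (q : R) m :
  0 < q < 1 -> qint q m <= (1 - q)^-1.
Proof.
move=> /andP[q0 q1].
rewrite -(@ler_pM2l _ (1 - q)) ?subr_gt0// qintE divff ?gt_eqF ?subr_gt0//.
by rewrite gerBl exprn_ge0 ?ltW.
Qed.

(** The ratio is a product of [k] q-integers, each tending to [1 / (1 - q)]. *)
Lemma cvg_qfact_ratio (R : realType) (q : R) k : 0 < q < 1 ->
  qfact q (m + k) / qfact q m @[m --> \oo] --> (1 - q) ^- k.
Proof.
move=> q01; have /andP[q0 q1] := q01; elim: k => [|k IH].
  under eq_fun do rewrite addn0 divff ?gt_eqF ?qfact_gt0//.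
  by rewrite expr0 invr1; exact: cvg_cst.
under eq_fun do rewrite addnS qfactS -addnS mulrAC.
rewrite exprSr invfM; apply: cvgM => //.
have := cvg_qint q01; rewrite -(cvg_shiftn k.+1); exact.
Qed.

Lemma qfact_ratio_le (R : realType) (q : R) k m : 0 < q < 1 ->
  qfact q (m + k) / qfact q m <= (1 - q) ^- k.
Proof.
move=> q01; have /andP[q0 q1] := q01; elim: k => [|k IH].
  by rewrite addn0 divff ?gt_eqF ?qfact_gt0// expr0 invr1.
rewrite addnS qfactS mulrAC exprSr invfM.
apply: ler_pM => //; [| |exact: qint_le_lim].
- by rewrite divr_ge0 ?ltW ?qfact_gt0.
- exact/qint_ge0/ltW.
Qed.

(** The q-Pochhammer symbol [(-u; q)_m], used at [u = x / (1 - x)]. *)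
Definition euler_prod {R : realType} (q u : R) (m : nat) : R :=
  \prod_(0 <= j < m) (1 + q ^+ j * u).

Lemma euler_prod_homo (R : realType) (q u : R) : 0 <= q -> 0 <= u ->
  {homo euler_prod q u : m n / (m <= n)%N >-> m <= n}.
Proof.
move=> q0 u0; have F j : 1 <= 1 + q ^+ j * u by rewrite lerDl mulr_ge0 ?exprn_ge0.
apply: homo_leq => [//|? ? ?|m]; first exact: le_trans.
rewrite /euler_prod big_nat_recr//= ler_peMr//.
by apply: prodr_ge0 => j _; exact: le_trans ler01 (F j).
Qed.

Lemma euler_prod_ge1 (R : realType) (q u : R) m :
  0 <= q -> 0 <= u -> 1 <= euler_prod q u m.
Proof.
move=> q0 u0; apply: le_trans (euler_prod_homo q0 u0 (leq0n m)).
by rewrite /euler_prod big_geq.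
Qed.

(** The products increase and, by [1 + y <= expR y], stay below [expR (u / (1 - q))]. *)
Lemma is_cvg_euler_prod (R : realType) (q u : R) :
  0 < q < 1 -> 0 <= u -> cvgn (euler_prod q u).
Proof.
move=> q01 u0; have /andP[q0 q1] := q01.
apply: nondecreasing_is_cvgn; first exact: euler_prod_homo (ltW q0) u0.
exists (expR ((1 - q)^-1 * u)) => _ [m _ <-].
apply: le_trans (_ : expR (qint q m * u) <= _); last first.
  by rewrite ler_expR ler_wpM2r// qint_le_lim.
elim: m => [|m IH].
  by rewrite /euler_prod big_geq// qint0 mul0r expR0.
rewrite /euler_prod big_nat_recr//= qintS mulrDl expRD.
apply: ler_pM => //; last exact: expR_ge1Dx.
- exact: le_trans ler01 (euler_prod_ge1 m (ltW q0) u0).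
- by rewrite addr_ge0// mulr_ge0 ?exprn_ge0 ?(ltW q0).
Qed.

Lemma limit_lupas_basisE (R : realType) (k : nat) (q x : R) :
  limit_lupas_basis k q x =
  q ^+ (k * (k - 1) %/ 2) * (x / (1 - x)) ^+ k / qfact q k *
  (1 - q) ^- k / limn (euler_prod q (x / (1 - x))).
Proof. by rewrite /limit_lupas_basis !invfM; ring. Qed.

(** Each factor absorbs one [1 - x]; the factor [j = 0] becomes 1, so the right-hand product starts
    at 1. *)
Lemma euler_prod_lupas (R : realType) (q x : R) m : x != 1 -> (0 < m)%N ->
  euler_prod q (x / (1 - x)) m * (1 - x) ^+ m =
  \prod_(1 <= j < m) (1 - x + q ^+ j * x).
Proof.
move=> x1; case: m => // m _.
have x1' : 1 - x != 0 by rewrite subr_eq0 eq_sym.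
rewrite /euler_prod; elim: m => [|m IH].
  by rewrite big_nat1 big_geq// expr0 expr1; field.
rewrite big_nat_recr//= [RHS]big_nat_recr//= -IH [(1 - x) ^+ m.+2]exprSr.
by rewrite mulrACA; congr (_ * _); field.
Qed.

(** Isolates the dependence on [m] in two factors with known limits: a ratio of q-factorials and an
    Euler product. *)
Lemma lupas_basisE (R : realType) (m k : nat) (q x : R) :
  x != 1 -> (0 < m + k)%N ->
  lupas_basis (m + k) q x k =
  q ^+ (k * (k - 1) %/ 2) * (x / (1 - x)) ^+ k / qfact q k *
  (qfact q (m + k) / qfact q m) / euler_prod q (x / (1 - x)) (m + k).
Proof.
move=> x1 mk0; have x1' : 1 - x != 0 by rewrite subr_eq0 eq_sym.
rewrite /lupas_basis -euler_prod_lupas// /qbinom addnK expr_div_n exprD !invfM.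
have E0 : (1 - x) ^+ m / (1 - x) ^+ m = 1 by rewrite divff ?expf_neq0.
rewrite -[RHS]mulr1 -[X in _ = _ * X]E0; ring.
Qed.

Lemma cvg_lupas_basis (R : realType) (q x : R) k :
  0 < q < 1 -> 0 <= x < 1 ->
  lupas_basis m q x k @[m --> \oo] --> limit_lupas_basis k q x.
Proof.
move=> q01 /andP[x0 x1]; have /andP[q0 q1] := q01.
have u0 : 0 <= x / (1 - x) by rewrite divr_ge0// subr_ge0 ltW.
have cP := is_cvg_euler_prod q01 u0.
have P0 : limn (euler_prod q (x / (1 - x))) != 0.
  rewrite gt_eqF//; apply: lt_le_trans (ltr01) _.
  apply: le_trans (euler_prod_ge1 0 (ltW q0) u0) _.
  exact: nondecreasing_cvgn_le (euler_prod_homo (ltW q0) u0) cP _.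
rewrite -(cvg_shiftn k) limit_lupas_basisE.
apply: (@cvg_trans _ ((fun m => q ^+ (k * (k - 1) %/ 2) * (x / (1 - x)) ^+ k /
  qfact q k * (qfact q (m + k) / qfact q m) /
  euler_prod q (x / (1 - x)) (m + k)) @ \oo)).
  apply: near_eq_cvg; near=> m.
  rewrite /= lupas_basisE ?lt_eqF// addn_gt0; apply/orP; left.
  by near: m; exact: nbhs_infty_gt.
apply: cvgM; last first.
  by apply: cvgV => //; have := cP; rewrite /= -(cvg_shiftn k).
by apply: cvgM; [exact: cvg_cst | exact: cvg_qfact_ratio].
Unshelve. all: by end_near. Qed.

(** The Euler product is at least 1 and the q-factorial ratio is below its limit. The bound is free
    of [m], as dominated convergence demands. *)
Lemma lupas_basis_le (R : realType) (q x : R) m k :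
  0 < q < 1 -> 0 <= x < 1 -> (0 < m)%N -> (k <= m)%N ->
  lupas_basis m q x k <=
  limn (euler_prod q (x / (1 - x))) * limit_lupas_basis k q x.
Proof.
move=> q01 /andP[x0 x1] m0 km; have /andP[q0 q1] := q01.
have u0 : 0 <= x / (1 - x) by rewrite divr_ge0// subr_ge0 ltW.
have P1 : 0 < limn (euler_prod q (x / (1 - x))).
  apply: lt_le_trans (ltr01) _.
  apply: le_trans (euler_prod_ge1 0 (ltW q0) u0) _.
  apply: nondecreasing_cvgn_le (euler_prod_homo (ltW q0) u0) _ _.
  exact: is_cvg_euler_prod.
rewrite limit_lupas_basisE mulrC divfK ?gt_eqF//.
rewrite -{1}(subnK km) lupas_basisE ?lt_eqF ?subnK//.
have a0 : 0 <= q ^+ (k * (k - 1) %/ 2) * (x / (1 - x)) ^+ k / qfact q k.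
  by rewrite divr_ge0 ?mulr_ge0 ?exprn_ge0 ?(ltW q0) ?(ltW (qfact_gt0 k q0)).
set a := (X in 0 <= X) in a0 *.
have r0 : 0 <= qfact q m / qfact q (m - k) by rewrite divr_ge0 ?ltW ?qfact_gt0.
apply: le_trans (_ : a * (qfact q m / qfact q (m - k)) <= _).
  apply: ler_piMr; first exact: mulr_ge0.
  rewrite invf_le1; first exact: euler_prod_ge1 (ltW q0) u0.
  exact: lt_le_trans ltr01 (euler_prod_ge1 m (ltW q0) u0).
by apply: ler_wpM2l => //; rewrite -{1}(subnK km); exact: qfact_ratio_le.
Qed.

(** Each partial sum is a limit of partial sums of degree [m] basis functions, which are nonnegative
    with total 1. *)
Lemma is_cvg_limit_lupas_basis (R : realType) (q x : R) :
  0 < q < 1 -> 0 <= x < 1 -> cvgn (series (fun k => limit_lupas_basis k q x)).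
Proof.
move=> q01 x01; have /andP[q0 q1] := q01; have /andP[x0 x1] := x01.
have x01' : 0 <= x <= 1 by rewrite x0 ltW.
have b0 k : 0 <= limit_lupas_basis k q x.
  apply: cvgn_ge_cst (cvg_lupas_basis q01 x01) _.
  by near=> m; exact: lupas_basis_ge0.
apply: nondecreasing_is_cvgn.
  move=> i j ij; rewrite -subr_ge0 sub_series_geq//.
  by apply: sumr_ge0.
exists 1 => _ [N _ <-]; rewrite /series/=.
have cN := @cvg_sum_nat _ _ _ N (fun k => cvg_lupas_basis (k := k) q01 x01).
apply: cvgn_le_cst cN _.
near=> m.
have m0 : (0 < m)%N by near: m; exact: nbhs_infty_gt.
have Nm : (N <= m.+1)%N by apply: leqW; near: m; exact: nbhs_infty_ge.
rewrite -(sum_lupas_basis q0 x01' m0) -(big_mkord xpredT (lupas_basis m q x)).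
rewrite [leRHS](big_cat_nat _ (n := N))//= lerDl.
by apply: sumr_ge0 => k _; exact: lupas_basis_ge0.
Unshelve. all: by end_near. Qed.

(** * Convergence of the operators *)

Lemma cvg_qint_ratio (R : realType) (q : R) k : 0 < q < 1 ->
  qint q k / qint q m @[m --> \oo] --> 1 - q ^+ k.
Proof.
move=> q01; have /andP[q0 q1] := q01.
rewrite -qintE mulrC -[1 - q]invrK; apply: cvgM; first exact: cvg_cst.
by apply: cvgV; [rewrite invr_eq0 gt_eqF ?subr_gt0 | exact: cvg_qint].
Qed.

(** At [x = 1] all basis functions of index below [n] vanish, so the last one equals 1 by the
    partition of unity. *)
Lemma lupas_at1 (R : realType) (q : R) f n :
  0 < q -> (0 < n)%N -> lupas n q f 1 = f 1.
Proof.
move=> q0 n0.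
have bas k : (k < n)%N -> lupas_basis n q 1 k = 0.
  move=> kn; rewrite /lupas_basis subrr expr0n subn_eq0 leqNgt kn.
  by rewrite mulr0 mul0r mulr0.
have x01 : 0 <= (1 : R) <= 1 by rewrite ler01 lexx.
have := sum_lupas_basis q0 x01 n0.
rewrite lupasE !big_ord_recr/= big1 => [|k _]; last exact: bas.
rewrite add0r => ->; rewrite big1 ?add0r ?mulr1 => [|k _].
  by rewrite divff// gt_eqF// qint_gt0.
by rewrite bas ?mulr0.
Qed.

Lemma bounded_within01 (R : realType) (f : R -> R) :
  {within `[0, 1], continuous f} ->
  exists M, forall z, 0 <= z <= 1 -> `|f z| <= M.
Proof.
move=> cf; have [c _ fc] := EVT_max ler01 cf.
have [d _ fd] := EVT_min ler01 cf.
exists (`|f c| + `|f d|) => z z01.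
have zI : z \in `[0, 1] by rewrite in_itv.
have := fc z zI; have := fd z zI.
have := ler_norm (f c); have := ler_norm (- f d); rewrite normrN.
have := normr_ge0 (f c); have := normr_ge0 (f d).
by rewrite ler_norml; lra.
Qed.

Lemma cvg_lupas (R : realType) (f : R -> R) (q x : R) :
  0 < q < 1 -> 0 <= x <= 1 -> {within `[0, 1], continuous f} ->
  lupas m q f x @[m --> \oo] --> limit_lupas q f x.
Proof.
move=> q01 x01 cf; have /andP[q0 q1] := q01; have /andP[x0 x1] := x01.
rewrite /limit_lupas lt_eqF//.
have [->|xn1] := eqVneq x 1.
  apply: cvg_near_cst; near=> m; apply: lupas_at1 => //.
  by near: m; exact: nbhs_infty_gt.
have x01' : 0 <= x < 1 by rewrite x0 lt_neqAle xn1.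
have [M fM] := bounded_within01 cf.
have M0 : 0 <= M by apply: le_trans (normr_ge0 _) (fM 0 _); rewrite lexx ler01.
pose T m k := f (qint q k / qint q m) * lupas_basis m q x k.
have -> : (fun m => lupas m q f x) = (fun m => \sum_(0 <= k < m.+1) T m k).
  by apply/funext => m; rewrite lupasE big_mkord.
pose P := limn (euler_prod q (x / (1 - x))).
apply: (@cvg_sum_dominated _ _ _ ((M * P) *: (fun k => limit_lupas_basis k q x))).
- move=> k; apply: cvgM; last exact: cvg_lupas_basis.
  have qk01 : (1 - q ^+ k) \in `[0, 1].
    by rewrite in_itv/= subr_ge0 exprn_ile1 ?gerBl ?exprn_ge0 ?ltW.
  move/subspace_continuousP : cf => /(_ _ qk01) cfk.
  (* Continuity is relative to [[0, 1]], so the nodes must be shown to lie there; they do once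
     [k <= m]. *)
  apply: cvg_comp cfk => S /=; rewrite /within/= => nS.
  have cq := cvg_qint_ratio (k := k) q01.
  near=> m.
  have km : (k <= m)%N by near: m; exact: nbhs_infty_ge.
  have m0 : (0 < m)%N by near: m; exact: nbhs_infty_gt.
  suff : `[0, 1]%classic (qint q k / qint q m) -> S (qint q k / qint q m).
    apply; rewrite /= in_itv/= divr_ge0 ?qint_ge0 ?(ltW q0)//=.
    by rewrite ler_pdivrMr ?qint_gt0// mul1r qint_le ?(ltW q0).
  by near: m; exact: (cq _ nS).
- near=> m => k km.
  have m0 : (0 < m)%N by near: m; exact: nbhs_infty_gt.
  rewrite /T normrM (ger0_norm (lupas_basis_ge0 _ _ q0 x01)).
  rewrite [leRHS]/= -[X in _ <= X]/(M * P * limit_lupas_basis k q x) -mulrA.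
  apply: ler_pM => //; [exact: lupas_basis_ge0 | | exact: lupas_basis_le].
  apply: fM; rewrite divr_ge0 ?qint_ge0 ?(ltW q0)//=.
  by rewrite ler_pdivrMr ?qint_gt0// mul1r qint_le ?(ltW q0).
- by apply: is_cvg_seriesZ; exact: is_cvg_limit_lupas_basis.
Unshelve. all: by end_near. Qed.

(** * Error bounds and the modulus of smoothness *)

(** The comparison of degrees [n] and [m] has a bound free of [m]. Leaving [t] free serves both
    [t ^+ 2 = q ^+ n] and [t ^+ 2 = 1 / n]. *)
Lemma lupas_limit_error (R : realType) (f : R -> R) (q t w x : R) n :
  0 < q < 1 -> 0 <= x <= 1 -> (0 < n)%N -> {within `[0, 1], continuous f} ->
  0 < t <= 1 -> q ^+ n / qint q n <= t ^+ 2 ->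
  0 <= w -> second_difference_le f t w ->
  `|lupas n q f x - limit_lupas q f x| <= 5 * w.
Proof.
move=> q01 x01 n0 cf t01 qt w0 fw; have /andP[q0 q1] := q01.
have [M fM] := bounded_within01 cf.
have cd : `|lupas n q f x - lupas m q f x| @[m --> \oo] -->
          `|lupas n q f x - limit_lupas q f x|.
  by apply: cvg_norm; apply: cvgB; [exact: cvg_cst | exact: cvg_lupas].
apply: cvgn_le_cst cd _; near=> m.
have nm : (n <= m)%N by near: m; exact: nbhs_infty_ge.
have m0 := leq_trans n0 nm.
apply: (mean_functional_compare (mean_functional_lupas q0 x01 n0)
  (mean_functional_lupas q0 x01 m0) _ _ _ t01 w0 fM fw).
- by rewrite !lupas_id.
- by move=> a; exact: lupas_hinge_noninc.
- by apply: le_trans qt; apply: lupas_sqr_gap => //; rewrite q0 ltW.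
Unshelve. all: by end_near. Qed.

(** Jensen's inequality, since a hinge is the maximum of two affine functions. *)
Lemma mean_functional_hinge (R : realType) (A : (R -> R) -> R) a :
  mean_functional A -> hinge a (A id) <= A (hinge a).
Proof.
move=> mA; case: (mA) => lin mono cst; rewrite /hinge ge_max; apply/andP; split.
  by rewrite -[leLHS](cst 0); apply: mono => y _; rewrite le_max lexx.
have -> : A id - a = 1 * A id + A (fun _ => - a) by rewrite cst mul1r.
by rewrite -lin; apply: mono => y _; rewrite mul1r le_max lexx orbT.
Qed.

Lemma bernstein_error (R : realType) (f : R -> R) (t w x : R) n :
  0 <= x <= 1 -> (0 < n)%N -> {within `[0, 1], continuous f} ->
  0 < t <= 1 -> n%:R^-1 <= t ^+ 2 ->
  0 <= w -> second_difference_le f t w -> `|lupas n 1 f x - f x| <= 5 * w.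
Proof.
move=> x01 n0 cf t01 nt w0 fw.
have [M fM] := bounded_within01 cf.
have mA := mean_functional_lupas ltr01 x01 n0.
have mB : mean_functional (fun f : R -> R => f x) by split => // f' g; apply.
have idx : lupas n 1 id x = x by exact: lupas_id.
apply: (mean_functional_compare mA mB _ _ _ t01 w0 fM fw) => //.
- by move=> a; have := mean_functional_hinge a mA; rewrite idx.
- rewrite bernstein_sqr// addrC addKr; apply: le_trans nt.
  have n1 : 0 <= n%:R^-1 :> R by rewrite invr_ge0.
  by rewrite ler_piMl//; nra.
Qed.

Lemma omega2_ge0 (R : realType) (f : R -> R) t : 0 <= t -> (0 <= omega2 f t)%E.
Proof.
move=> t0; apply: le_trans (ereal_sup_ubound _); last first.
  by exists 0 => //=; rewrite lexx t0 mulr0 ler01.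
apply: le_trans (ereal_sup_ubound _); last first.
  by exists 0 => //=; rewrite in_itv/= mulr0 subr0 lexx ler01.
by rewrite lee_fin.
Qed.

Lemma omega2_second_difference (R : realType) (f : R -> R) t w :
  omega2 f t = w%:E -> second_difference_le f t w.
Proof.
move=> fw h x /andP[h0 ht] x0 xh.
rewrite -lee_fin -fw.
apply: le_trans (ereal_sup_ubound _); last first.
  by exists h => //=; rewrite h0 ht; split => //; lra.
by apply: ereal_sup_ubound; exists x => //=; rewrite in_itv/= x0; lra.
Qed.

(** Reduces extended reals to real bounds: an infinite modulus makes the claim trivial, and
    nonnegativity excludes minus infinity. *)
Lemma supnorm01_le_omega2 (R : realType) (f g : R -> R) t c :
  0 < c -> 0 <= t ->
  (forall w, 0 <= w -> second_difference_le f t w ->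
     forall x, 0 <= x <= 1 -> `|g x| <= c * w) ->
  (supnorm01 g <= c%:E * omega2 f t)%E.
Proof.
move=> c0 t0 gw; have := omega2_ge0 f t0.
case E : (omega2 f t) => [w||] // w0; last by rewrite gt0_muley ?lte_fin ?leey.
apply: ge_ereal_sup => _ [x /= xI <-]; rewrite in_itv/= in xI.
rewrite -EFinM lee_fin; apply: gw => //.
exact: omega2_second_difference.
Qed.

Theorem theorem15 (R : realType) :
  exists c : R, 0 < c /\
    forall (f : R -> R) (n : nat),
      {within `[0, 1], continuous f} -> (1 <= n)%N ->
      (forall q : R, 0 < q < 1 ->
         (supnorm01 (fun x => lupas n q f x - limit_lupas q f x)%R
          <= c%:E * omega2 f (Num.sqrt (q ^+ n))%R)%E) /\
      (ereal_sup [set supnorm01 (fun x => lupas n q f x - limit_lupas q f x)%R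
                 | q in [set q : R | (0 < q <= 1)%R]]
       <= c%:E * omega2 f ((Num.sqrt n%:R)^-1)%R)%E.
Proof.
exists 5; split; first by [].
move=> f n cf n0; split=> [q q01|].
  have /andP[q0 q1] := q01; have qn : 0 < q ^+ n by rewrite exprn_gt0.
  apply: supnorm01_le_omega2 => // w w0 fw x x01.
  apply: (lupas_limit_error q01 x01 n0 cf _ _ w0 fw).
    by rewrite sqrtr_gt0 qn -[leRHS]sqrtr1 ler_sqrt ?exprn_ile1 ?(ltW q0) ?(ltW q1).
  (* Here [q ^+ n / [n] <= q ^+ n] because [[n] >= [1] = 1]. *)
  rewrite sqr_sqrtr ?(ltW qn)// ler_pdivrMr ?qint_gt0// ler_peMr ?(ltW qn)//.
  by rewrite -(qint1 q) qint_le ?(ltW q0).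
have nR : 1 <= n%:R :> R by rewrite ler1n.
have n0R : 0 < n%:R :> R by rewrite ltr0n.
have sn0 : 0 < (Num.sqrt (n%:R : R))^-1 by rewrite invr_gt0 sqrtr_gt0.
have t01 : 0 < (Num.sqrt (n%:R : R))^-1 <= 1.
  by rewrite sn0 invf_le1 ?sqrtr_gt0// -[leLHS]sqrtr1 ler_sqrt.
have t2 : (Num.sqrt (n%:R : R))^-1 ^+ 2 = n%:R^-1.
  by rewrite exprVn sqr_sqrtr// ltW.
apply: ge_ereal_sup => _ [q /= q01 <-]; have /andP[q0 q1] := q01.
apply: supnorm01_le_omega2 => // w w0 fw x x01.
have [->|qn1] := eqVneq q 1.
  rewrite /limit_lupas eqxx.
  by apply: (bernstein_error x01 n0 cf t01 _ w0 fw); rewrite t2.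
have q01' : 0 < q < 1 by rewrite q0 lt_neqAle qn1.
apply: (lupas_limit_error q01' x01 n0 cf t01 _ w0 fw).
(* The condition [q ^+ n / [n] <= 1 / n] is rearranged into [n * q ^+ n <= [n]]. *)
rewrite t2 ler_pdivrMr ?qint_gt0// mulrC ler_pdivlMr// mulrC.
by apply: qint_ge_expn; rewrite ltW.
Qed.
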